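(* Let $n$ and $k$ be positive integers, and let $c\colon E(K_{2kn})\to [k]$ be a colour-balanced edge-colouring of the complete graph $K_{2kn}$ on $2kn$ vertices, where $[k]=\{1,2,\dots,k\}$. Then there is a perfect matching $M$ of $K_{2kn}$ satisfying $$f(M)\le k\sqrt{2n},\qquad\text{where}\qquad f(M)=\sum_{i=1}^k\Bigl|\,|c^{-1}(i)\cap M|-n\,\Bigr|.$$
   Context: An edge-colouring $c\colon E(G)\to[k]$ of a graph $G$ is called colour-balanced if each colour $i\in[k]$ is used on exactly the same number of edges, i.e. $|c^{-1}(i)|=|E(G)|/k$ for all $i$. For a perfect matching $M$, $|c^{-1}(i)\cap M|$ is the number of edges of $M$ having colour $i$. *)

(* Defs.v *)
From mathcomp Require Import all_boot all_order all_algebra.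

Set Implicit Arguments.
Unset Strict Implicit.
Unset Printing Implicit Defensive.

Import Order.TTheory GRing.Theory Num.Theory.

Local Open Scope ring_scope.

(* The edges of the complete graph with vertex set T: the 2-element subsets. *)
Definition edge (T : finType) : finType := {e : {set T} | #|e| == 2%N}.

Definition colour_class (T : finType) (k : nat) (c : edge T -> 'I_k)
    (i : 'I_k) : {set edge T} :=
  [set e | c e == i].

(* The division is exact rational division, so k must divide the number of
   edges for such a colouring to exist. *)
Definition colour_balanced (T : finType) (k : nat) (c : edge T -> 'I_k) : Prop :=
  forall i : 'I_k, #|colour_class c i|%:R = #|edge T|%:R / k%:R :> rat.

Definition perfect_matching (T : finType) (M : {set edge T}) : Prop :=
  forall v : T, #|[set e in M | v \in val e]| = 1%N.

(* The subtraction takes place in R, not in nat, where it would truncate. *)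
Definition imbalance (R : rcfType) (T : finType) (k n : nat)
    (c : edge T -> 'I_k) (M : {set edge T}) : R :=
  \sum_(i < k) `| #|colour_class c i :&: M|%:R - n%:R |.
Arguments imbalance R {T k} n c M.

(* Main.v *)
(* Second moment method over all perfect matchings of K_{2N}, N = kn. By the
   symmetry of the vertex set, every edge lies in the same number p of perfect
   matchings and every pair of disjoint edges in the same number q; double
   counting gives (2N - 1) p = #|PM| and (2N - 3) q = p. If X_i is the number of
   edges of colour i in M, then summing X_i^2 over M counts the matchings through
   pairs of edges of colour i, so for k >= 2 the mean of X_i^2 is at most
   n^2 + 2n. Some M is thus such that the X_i^2 add up to at most k (n^2 + 2n);
   as the X_i add up to kn, the (X_i - n)^2 add up to at most 2nk, and
   Cauchy-Schwarz concludes. *)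
Require Import Defs.
From mathcomp Require Import all_boot all_order all_algebra.
From mathcomp Require Import all_fingroup primitive_action alt zify ring lra.

Set Implicit Arguments.
Unset Strict Implicit.
Unset Printing Implicit Defensive.

Import Order.TTheory GRing.Theory Num.Theory.

(** * Permutations of the vertices and their action on edges *)

Lemma perm_map_uniq (T : finType) (s t : seq T) :
  uniq s -> uniq t -> size s = size t -> exists p : {perm T}, map p s = t.
Proof.
move=> Us Ut est.
have sT : size t <= #|T| by rewrite -(card_uniqP Ut) max_card.
(* The symmetric group is transitive on duplicate-free tuples of each length up to [#|T|]. *)
have tr := ntransitive_weak sT (Sym_trans T).
have Us' : tcast est (in_tuple s) \in (size t).-dtuple([set: T]).
  by apply/setIdP; rewrite val_tcast Us; split=> //; apply/subsetP.
have Ut' : in_tuple t \in (size t).-dtuple([set: T]).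
  by apply/setIdP; rewrite Ut; split=> //; apply/subsetP.
have [p _ /(congr1 val) def_t] := atransP2 tr Us' Ut'.
by exists p; rewrite [RHS]def_t /= val_tcast.
Qed.

Section PerfectMatchings.
Variable T : finType.
Implicit Types (s : {perm T}) (e f : edge T) (M A : {set edge T}).

Fact edge_map_subproof s e : #|s @: val e| == 2.
Proof. by rewrite card_imset ?(valP e) //; apply: perm_inj. Qed.

Definition edge_map s e : edge T := Sub (s @: val e) (edge_map_subproof s e).

Lemma edge_map_inj s : injective (edge_map s).
Proof.
by move=> e f /(congr1 val) /= /(imset_inj (@perm_inj _ s)); apply: val_inj.
Qed.

Lemma mem_edge_map s e v : (s v \in val (edge_map s e)) = (v \in val e).
Proof. by rewrite /= mem_imset //; apply: perm_inj. Qed.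

Lemma edgeP e : exists x y, x != y /\ val e = [set x; y].
Proof. exact/cards2P/(valP e). Qed.

Lemma edge_map_trans e f : exists s, edge_map s e = f.
Proof.
have [x [y [xy de]]] := edgeP e; have [z [t [zt df]]] := edgeP f.
have [||//|s [sx sy]] := @perm_map_uniq T [:: x; y] [:: z; t].
- by rewrite /= inE xy.
- by rewrite /= inE zt.
exists s; apply: val_inj => /=.
by rewrite de df imsetU !imset_set1 sx sy.
Qed.

(** The four endpoints of two disjoint edges are distinct, so some permutation moves them in order
    onto the endpoints of the other pair. *)
Lemma edge_map_trans2 e1 f1 e2 f2 :
    [disjoint val e1 & val f1] -> [disjoint val e2 & val f2] ->
  exists s, edge_map s e1 = e2 /\ edge_map s f1 = f2.
Proof.
have uniq4 (x y z t : T) : x != y -> z != t ->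
    [disjoint [set x; y] & [set z; t]] -> uniq [:: x; y; z; t].
  move=> xy zt /pred0P dis.
  rewrite /= !inE !negb_or xy zt /= andbT.
  have := dis x; have := dis y; rewrite !inE !eqxx orbT /=.
  by move=> /negbT + /negbT; rewrite !negb_or => -> ->.
have [x1 [y1 [xy1 de1]]] := edgeP e1; have [z1 [t1 [zt1 df1]]] := edgeP f1.
have [x2 [y2 [xy2 de2]]] := edgeP e2; have [z2 [t2 [zt2 df2]]] := edgeP f2.
rewrite de1 df1 de2 df2 => /(uniq4 _ _ _ _ xy1 zt1) U1.
move=> /(uniq4 _ _ _ _ xy2 zt2) U2.
have [//|s [sx sy sz st]] := perm_map_uniq U1 U2.
exists s; split; apply: val_inj => /=.
  by rewrite de1 de2 imsetU !imset_set1 sx sy.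
by rewrite df1 df2 imsetU !imset_set1 sz st.
Qed.

(** * Perfect matchings and their symmetry *)

Definition perfect_matchings : {set {set edge T}} :=
  [set M : {set edge T} | [forall v, #|[set e in M | v \in val e]| == 1]].

Lemma perfect_matchingsP M :
  reflect (perfect_matching M) (M \in perfect_matchings).
Proof. by rewrite inE; apply: (iffP forallP) => pM v; apply/eqP/pM. Qed.

(** A common vertex lies on only one edge of [M], so two edges of [M] that meet coincide. *)
Lemma perfect_matching_disjoint M e f :
    perfect_matching M -> e \in M -> f \in M ->
  [disjoint val e & val f] = (e != f).
Proof.
move=> pM eM fM; apply/idP/idP => [dis|].
  apply: contraTneq dis => <-; rewrite -setI_eq0 setIid -cards_eq0.
  by rewrite (eqP (valP e)).
apply: contraR => /pred0Pn[v /andP[/= ve vf]].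
have /eqP/cards1P[g dg] := pM v.
have /set1P-> : e \in [set g] by rewrite -dg inE eM.
by have /set1P-> : f \in [set g] by rewrite -dg inE fM.
Qed.

(** Double counting of incidences: two vertices on each edge, one edge of [M] at each vertex. *)
Lemma card_perfect_matching M : perfect_matching M -> #|M|.*2 = #|T|.
Proof.
move=> pM; rewrite -sum1_card -muln2 big_distrl /= -sum1_card.
transitivity (\sum_(e in M) \sum_(v | v \in val e) 1).
  by apply: eq_bigr => e _; rewrite sum1_card (eqP (valP e)).
rewrite (exchange_big_dep predT) //=; apply: eq_bigr => v _.
by rewrite sum1dep_card -[RHS](pM v); apply: eq_card => e; rewrite !inE.
Qed.

Lemma edge_map_perfect_matching s M :
  perfect_matching M -> perfect_matching (edge_map s @: M).
Proof.
move=> pM v; rewrite -[RHS](pM (s^-1%g v)) -[RHS](card_imset _ (@edge_map_inj s)).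
apply: eq_card => e; apply/setIdP/imsetP => [[/imsetP[f fM ->]]|[f]].
  by rewrite -{1}(permKV s v) mem_edge_map => vf; exists f; rewrite // inE fM.
case/setIdP=> fM vf ->; split; first exact: imset_f.
by rewrite -(permKV s v) mem_edge_map.
Qed.

Definition matchings_through A : {set {set edge T}} :=
  [set M in perfect_matchings | A \subset M].

(** Applying [s] to matchings is injective and preserves perfection. The inequality suffices: in the
    two lemmas below, exchanging the roles of the edges gives the reverse one. *)
Lemma leq_card_matchings_through s A :
  #|matchings_through A| <= #|matchings_through (edge_map s @: A)|.
Proof.
rewrite -(card_imset _ (imset_inj (@edge_map_inj s))).
apply/subset_leq_card/subsetP => _ /imsetP[M /setIdP[/perfect_matchingsP pM AM] ->].
rewrite inE imsetS // andbT; apply/perfect_matchingsP.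
exact: edge_map_perfect_matching.
Qed.

Lemma card_matchings_through1 e f :
  #|matchings_through [set e]| = #|matchings_through [set f]|.
Proof.
suff le1 e1 e2 : #|matchings_through [set e1]| <= #|matchings_through [set e2]|.
  by apply/eqP; rewrite eqn_leq !le1.
have [s <-] := edge_map_trans e1 e2.
by have := leq_card_matchings_through s [set e1]; rewrite imset_set1.
Qed.

Lemma card_matchings_through2 e1 f1 e2 f2 :
    [disjoint val e1 & val f1] -> [disjoint val e2 & val f2] ->
  #|matchings_through [set e1; f1]| = #|matchings_through [set e2; f2]|.
Proof.
suff le2 e f e' f' : [disjoint val e & val f] -> [disjoint val e' & val f'] ->
    #|matchings_through [set e; f]| <= #|matchings_through [set e'; f']|.
  by move=> d1 d2; apply/eqP; rewrite eqn_leq !le2.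
move=> d d'; have [s [<- <-]] := edge_map_trans2 d d'.
have := leq_card_matchings_through s [set e; f].
by rewrite imsetU !imset_set1.
Qed.

(** * Double counting of edges against matchings *)

Lemma card_edge : #|edge T| = 'C(#|T|, 2).
Proof. by rewrite card_sig -card_draws cardsE. Qed.

Lemma card_disjoint_edges e :
  #|[set f : edge T | [disjoint val e & val f]]| = 'C(#|T| - 2, 2).
Proof.
have <- : #|~: val e| = #|T| - 2 by rewrite cardsCs setCK (eqP (valP e)).
rewrite -cards_draws -(card_imset _ (@val_inj _ _ (edge T))).
apply: eq_card => A; rewrite inE; apply/imsetP/andP => [[f]|[Ae A2]].
  by rewrite inE => dis ->; rewrite (valP f) subsets_disjoint setCK disjoint_sym.
exists (Sub A A2) => //.
by rewrite inE /= disjoint_sym -(setCK (val e)) -subsets_disjoint.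
Qed.

Lemma sum_card_matchings_through1 (C : {set edge T}) :
  \sum_(e in C) #|matchings_through [set e]| =
  \sum_(M in perfect_matchings) #|C :&: M|.
Proof.
transitivity (\sum_(e in C) \sum_(M in perfect_matchings | e \in M) 1).
  apply: eq_bigr => e _; rewrite sum1dep_card; apply: eq_card => M.
  by rewrite !inE sub1set.
rewrite (exchange_big_dep (mem perfect_matchings)) => [|e M _ /andP[]] //=.
apply: eq_bigr => M pM; rewrite -sum1_card.
by apply: eq_bigl => e; rewrite in_setI pM.
Qed.

(** Both sides count triples [(e, f, M)] with [e] and [f] in [C :&: M]. The diagonal [e = f] is
    included, hence the full square on the right. *)
Lemma sum_card_matchings_through2 (C : {set edge T}) :
  \sum_(e in C) \sum_(f in C) #|matchings_through [set e; f]| =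
  \sum_(M in perfect_matchings) #|C :&: M| ^ 2.
Proof.
transitivity (\sum_(e in C) \sum_(M in perfect_matchings | e \in M) #|C :&: M|).
  apply: eq_bigr => e _.
  transitivity (\sum_(f in C)
     \sum_(M in perfect_matchings | (e \in M) && (f \in M)) 1).
    apply: eq_bigr => f _; rewrite sum1dep_card; apply: eq_card => M.
    by rewrite !inE subUset !sub1set.
  rewrite (exchange_big_dep [pred M | (M \in perfect_matchings) && (e \in M)])
    => [|f M _ /= /and3P[pM eM _]]; last exact/andP.
  apply: eq_bigr => M /andP[pM eM]; rewrite -sum1_card.
  by apply: eq_bigl => f; rewrite in_setI pM eM.
rewrite (exchange_big_dep (mem perfect_matchings)) => [|e M _ /andP[]] //=.
apply: eq_bigr => M pM; rewrite sum_nat_cond_const; congr (_ * _).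
by apply: eq_card => e; rewrite in_set in_setI pM.
Qed.

(** * Matching counts and second moments on [2N] vertices *)

Variable N : nat.
Hypothesis cardT : #|T| = N.*2.

(** Each matching has [N] edges, and each of the [N (2N - 1)] edges lies in equally many matchings;
    the common factor [N] cancels. *)
Lemma card_perfect_matchings e :
  0 < N -> #|perfect_matchings| = (N.*2).-1 * #|matchings_through [set e]|.
Proof.
move=> N0; apply/eqP; rewrite -(eqn_pmul2l N0) mulnA; apply/eqP.
transitivity (\sum_(f : edge T) #|matchings_through [set f]|); last first.
  under eq_bigr => f _ do rewrite (card_matchings_through1 f e).
  by rewrite sum_nat_const card_edge cardT bin2 -doubleMl doubleK.
have := sum_card_matchings_through1 [set: edge T].
under eq_bigl => f do rewrite in_setT.
move=> ->; rewrite mulnC -sum_nat_const; apply: eq_bigr => M /perfect_matchingsP pM.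
by rewrite setTI; apply/double_inj; rewrite card_perfect_matching.
Qed.

(** A matching through [e] has [N - 1] other edges, all among the [(N - 1)(2N - 3)] edges disjoint
    from [e]; the factor [N - 1] cancels, being positive. *)
Lemma card_matchings_through_edge e f :
    1 < N -> [disjoint val e & val f] ->
  #|matchings_through [set e]| = (N.*2 - 3) * #|matchings_through [set e; f]|.
Proof.
move=> N1 ef; have N0 : 0 < N.-1 by lia.
apply/eqP; rewrite -(eqn_pmul2l N0) mulnA; apply/eqP.
transitivity (\sum_(g : edge T | [disjoint val e & val g]) #|matchings_through [set e; g]|);
  last first.
  under eq_bigr => g eg do rewrite (card_matchings_through2 eg ef).
  rewrite sum_nat_cond_const card_disjoint_edges cardT bin2; congr (_ * _).
  have -> : (N.*2 - 2) = (N.-1).*2 by lia.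
  by rewrite -doubleMl doubleK; congr (_ * _); lia.
transitivity (\sum_(g : edge T | [disjoint val e & val g])
   \sum_(M in matchings_through [set e] | g \in M) 1); last first.
  apply: eq_bigr => g _; rewrite sum1dep_card; apply: eq_card => M.
  by rewrite !inE subUset !sub1set andbA.
rewrite (exchange_big_dep (mem (matchings_through [set e])))
  => [|g M _ /andP[]] //=.
rewrite mulnC -sum_nat_const; apply: eq_bigr => M tM.
have [/perfect_matchingsP pM] := setIdP tM; rewrite sub1set => eM.
have -> : N = #|M| by apply/double_inj; rewrite card_perfect_matching.
rewrite (cardsD1 e M) eM /= -sum1_card; apply: eq_bigl => g.
rewrite tM /= !inE; case gM: (g \in M); last by rewrite !andbF.
by rewrite (perfect_matching_disjoint pM eM gM) eq_sym !andbT.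
Qed.

Lemma matchings_through_conflict e f :
  e != f -> ~~ [disjoint val e & val f] -> matchings_through [set e; f] = set0.
Proof.
move=> ef nd; apply/setP => M; rewrite !inE; apply/negP.
case/andP=> pM; rewrite subUset !sub1set => /andP[eM fM].
move: nd; rewrite (perfect_matching_disjoint _ eM fM) ?ef //.
by apply/perfect_matchingsP; rewrite inE.
Qed.

(** The diagonal term is the count through [e] itself. Any other [f] contributes a fraction
    [1 / (2N - 3)] of it if disjoint from [e], and nothing otherwise. *)
Lemma sum_matchings_through_pair (C : {set edge T}) e : 1 < N -> e \in C ->
  (N.*2 - 3) * \sum_(f in C) #|matchings_through [set e; f]| <=
    #|matchings_through [set e]| * (N.*2 - 3 + #|C|.-1).
Proof.
move=> N1 eC; rewrite (bigD1 e) //= setUid !mulnDr [X in X + _]mulnC leq_add2l.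
rewrite (cardsD1 e C) eC /= big_distrr /= mulnC -sum_nat_const.
rewrite [X in X <= _](eq_bigl (mem (C :\ e))) => [|f]; last by rewrite !inE andbC.
apply: leq_sum => f /setD1P[fe _].
case: (boolP [disjoint val e & val f]) => [dis|nd].
  by rewrite (card_matchings_through_edge N1 dis).
by rewrite matchings_through_conflict 1?eq_sym // cards0 muln0.
Qed.

Lemma sum_card_setI_sq (C : {set edge T}) : 1 < N ->
  (N.*2).-1 * (N.*2 - 3) * \sum_(M in perfect_matchings) #|C :&: M| ^ 2 <=
    #|perfect_matchings| * (#|C| * (N.*2 - 3 + #|C|.-1)).
Proof.
move=> N1; rewrite -sum_card_matchings_through2 big_distrr /=.
rewrite [X in _ <= X]mulnCA -sum_nat_const.
apply: leq_sum => e eC; rewrite (card_perfect_matchings e) ?(ltnW N1) //.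
by rewrite -!mulnA leq_mul2l sum_matchings_through_pair ?orbT.
Qed.

Lemma sum_sq_balanced_class (C : {set edge T}) n :
    0 < n < N -> #|C| = n * (N.*2).-1 ->
  \sum_(M in perfect_matchings) #|C :&: M| ^ 2 <=
    #|perfect_matchings| * (n ^ 2 + n.*2).
Proof.
move=> /andP[n0 nN] cC; have N1 : 1 < N by lia.
have := sum_card_setI_sq C N1; rewrite cC.
set S := \sum_(M in _) _; set P := #|perfect_matchings| => le_S.
have D0 : 0 < (N.*2).-1 * (N.*2 - 3) by rewrite muln_gt0; lia.
rewrite -(leq_pmul2l D0); apply: leq_trans le_S _.
have -> : P * (n * N.*2.-1 * (N.*2 - 3 + (n * N.*2.-1).-1)) =
    (P * n * N.*2.-1) * (N.*2 - 3 + (n * N.*2.-1).-1) by rewrite !mulnA.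
have -> : N.*2.-1 * (N.*2 - 3) * (P * (n ^ 2 + n.*2)) =
    (P * n * N.*2.-1) * ((N.*2 - 3) * n.+2) by nia.
(* What remains is [n (2N - 1) - 1 <= (2N - 3)(n + 1)], which amounts to [n + 1 <= N]. *)
by rewrite leq_mul2l; apply/orP; right; nia.
Qed.

End PerfectMatchings.

(** * Existence of a perfect matching *)

Lemma involution_perfect_matching (T : finType) (g : T -> T) :
    involutive g -> (forall v, g v != v) ->
  perfect_matching [set e : edge T | [exists v, val e == [set v; g v]]].
Proof.
move=> gK gN v; apply/eqP/cards1P.
have gv2 : #|[set v; g v]| == 2 by rewrite cards2 [v == _]eq_sym gN.
exists (Sub [set v; g v] gv2); apply/setP => e; rewrite !inE -val_eqE /=.
(* If [v] lies in [[set w; g w]], then [w] is [v] or [g v], and either way the pair is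
   [[set v; g v]]. *)
apply/andP/eqP => [[/existsP[w /eqP->]]|->].
  by case/set2P=> -> //; rewrite gK setUC.
by rewrite set21; split=> //; apply/existsP; exists v.
Qed.

Lemma exists_perfect_matching m :
  ~~ odd m -> exists M : {set edge 'I_m}, perfect_matching M.
Proof.
move=> m_even.
(* The involution exchanges [2j] and [2j + 1]; since [m] is even, the successor of an even index
   stays in range. *)
have lt_flip (i : 'I_m) : (if odd i then i.-1 else i.+1) < m.
  by have := ltn_ord i; case: ifP; lia.
pose g i := Ordinal (lt_flip i).
have gK : involutive g by move=> i; apply: val_inj => /=; do 2!case: ifP; lia.
have gN i : g i != i by rewrite -val_eqE /=; case: ifP; lia.
by eexists; apply: involution_perfect_matching gK gN.
Qed.

(** * Colour classes and averaging over matchings *)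

Lemma sum_colour_class (T : finType) k (c : edge T -> 'I_k) (M : {set edge T}) :
  \sum_(i < k) #|colour_class c i :&: M| = #|M|.
Proof.
rewrite -[RHS]sum1_card (partition_big c predT) //=; apply: eq_bigr => i _.
by rewrite sum1dep_card; apply: eq_card => e; rewrite !inE andbC.
Qed.

Local Open Scope ring_scope.

Lemma colour_balanced_card (T : finType) (N n k : nat) (c : edge T -> 'I_k) i :
    #|T| = N.*2 -> (0 < k)%N -> N = (k * n)%N -> colour_balanced c ->
  #|colour_class c i| = (n * (N.*2).-1)%N.
Proof.
move=> cT k0 dN; have k_neq0 : k%:R != 0 :> rat by rewrite pnatr_eq0 -lt0n.
move=> /(_ i) /(canLR (divfK k_neq0)) /eqP; rewrite -natrM eqr_nat => /eqP.
rewrite card_edge cT bin2 -doubleMl doubleK dN => cC.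
by apply/eqP; rewrite -(eqn_pmul2l k0) mulnC cC mulnA.
Qed.

Lemma exists_small_second_moment (n k : nat) (hn : (0 < n)%N) (hk : (0 < k)%N)
    (c : edge 'I_(2 * k * n)%N -> 'I_k) : colour_balanced c ->
  exists M : {set edge 'I_(2 * k * n)%N}, perfect_matching M /\
    (\sum_(i < k) #|colour_class c i :&: M| ^ 2 <= k * (n ^ 2 + n.*2))%N.
Proof.
move=> hc; have cT : #|'I_(2 * k * n)| = (k * n).*2 by rewrite card_ord; lia.
have [M0 pM0] : exists M : {set edge 'I_(2 * k * n)}, perfect_matching M.
  by apply: exists_perfect_matching; lia.
(* For [k = 1] the condition [n < k * n] of the class bound fails, but then all [n] edges of any
   matching have the single colour and the sum is [n ^ 2]. *)
have [k1|k2] := leqP k 1.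
  exists M0; split=> //; have {k1 hk} ek : k = 1%N by lia.
  have := card_perfect_matching pM0; have := sum_colour_class c M0.
  rewrite cT; move: M0 pM0 c hc cT; rewrite ek => M0 _ c _ _.
  by rewrite !big_ord1 => ->; nia.
have nN : (0 < n < k * n)%N by nia.
pose B := (k * (n ^ 2 + n.*2))%N.
pose F (M : {set edge 'I_(2 * k * n)}) :=
  (\sum_(i < k) #|colour_class c i :&: M| ^ 2)%N.
have [/existsP[M /andP[/perfect_matchingsP pM FM]]|] :=
  boolP [exists M in perfect_matchings _, (F M <= B)%N]; first by exists M.
rewrite negb_exists => /forallP noM.
have : (\sum_(M in perfect_matchings 'I_(2 * k * n)) F M <=
        #|perfect_matchings 'I_(2 * k * n)| * B)%N.
  rewrite exchange_big /=.
  rewrite /B mulnCA -[X in (_ <= X * _)%N](card_ord k) -sum_nat_const.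
  apply: leq_sum => i _; apply: (sum_sq_balanced_class cT nN).
  exact: colour_balanced_card.
rewrite leqNgt.
(* If no matching met the bound, each integer [F M] would be at least [B + 1]; as there is at least
   one matching, this contradicts the averaged bound. *)
have : (#|perfect_matchings 'I_(2 * k * n)| * B.+1 <=
        \sum_(M in perfect_matchings 'I_(2 * k * n)) F M)%N.
  rewrite -sum_nat_const; apply: leq_sum => M pM.
  by move: (noM M); rewrite pM -ltnNge.
have P0 : (0 < #|perfect_matchings 'I_(2 * k * n)|)%N.
  by apply/card_gt0P; exists M0; apply/perfect_matchingsP.
by move=> le1 /negP[]; apply: leq_trans le1; rewrite ltn_pmul2l.
Qed.

Theorem theorem2p1 (R : rcfType) (n k : nat) (hn : (0 < n)%N) (hk : (0 < k)%N)
    (c : edge 'I_(2 * k * n)%N -> 'I_k) (hc : colour_balanced c) :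
  exists M : {set edge 'I_(2 * k * n)%N},
    perfect_matching M /\ imbalance R n c M <= k%:R * Num.sqrt (2 * n%:R).
Proof.
have [M [pM leM]] := exists_small_second_moment hn hk hc; exists M; split=> //.
have cM : #|M| = (k * n)%N.
  by apply/double_inj; rewrite card_perfect_matching // card_ord; lia.
set t := Num.sqrt _; have t2 : t ^+ 2 = 2 * n%:R by rewrite sqr_sqrtr ?mulr_ge0.
have t0 : 0 < t by rewrite sqrtr_gt0 mulr_gt0 ?ltr0n.
pose X i : R := #|colour_class c i :&: M|%:R.
have sum_sq : \sum_(i < k) (X i - n%:R) ^+ 2 <= k%:R * t ^+ 2.
  (* After expansion the bound is [k (n^2 + 2n) - 2n (kn) + k n^2 = 2kn], that is [k t^2]. *)
  have -> : \sum_(i < k) (X i - n%:R) ^+ 2 =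
      (\sum_(i < k) #|colour_class c i :&: M| ^ 2)%N%:R
      - 2 * n%:R * (\sum_(i < k) #|colour_class c i :&: M|)%N%:R
      + k%:R * n%:R ^+ 2.
    rewrite !natr_sum mulr_sumr -sumrB.
    have -> : k%:R * n%:R ^+ 2 = \sum_(i < k) n%:R ^+ 2 :> R.
      by rewrite sumr_const card_ord mulr_natl.
    by rewrite -big_split /=; apply: eq_bigr => i _; rewrite natrX /X; ring.
  rewrite sum_colour_class cM t2; move: leM; rewrite -(ler_nat R).
  rewrite -muln2 !(natrM, natrD, natrX); lra.
(* AM-GM: 2 t |a| <= a^2 + t^2. *)
have amgm : 2 * t * imbalance R n c M <= \sum_(i < k) ((X i - n%:R) ^+ 2 + t ^+ 2).
  rewrite mulr_sumr; apply: ler_sum => i _.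
  rewrite -[_ ^+ 2]real_normK ?num_real // -/(X i).
  have := sqr_ge0 (`|X i - n%:R| - t); rewrite sqrrB mulr2n; lra.
(* The squared deviations and the [k] copies of [t^2] each give at most [k t^2]; cancelling
   [2 t > 0] leaves [k t]. *)
have : 2 * t * imbalance R n c M <= 2 * t * (k%:R * t).
  apply: le_trans amgm _; rewrite big_split sumr_const card_ord /= -[t ^+ 2 *+ k]mulr_natl.
  have -> : 2 * t * (k%:R * t) = k%:R * t ^+ 2 + k%:R * t ^+ 2 by ring.
  by rewrite lerD2r.
by rewrite ler_pM2l // mulr_gt0.
Qed.
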